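(* Let $\varepsilon\ge0$, $d\in\mathbb{N}$, and let $h>0$ be a fixed step size. Let $b=(b_1,\ldots,b_d):\mathbb{R}^d\to\mathbb{R}^d$ and $\sigma_i:\mathbb{R}^d\to\mathbb{R}$, $i=1,\ldots,d$, be the coefficients of the SDE $\mathrm{d}X_{i,t}=b_i(X_t)\,\mathrm{d}t+\sigma_i(X_t)\,\mathrm{d}W_{i,t}$, $i=1,\ldots,d$, and suppose that for some non-empty $\Lambda\subseteq\{1,\ldots,d\}$, $$\lim_{\rho_\Lambda(x)\to\infty}\ \max_{i\in\Lambda}\ \mathrm{sign}(x_i)\,b_i(x)=-\infty .$$ Assume $\sigma_i(x)\ne0$ for every $i\in\Lambda$ and every state $x$ under consideration, where the states considered satisfy $x_i\neq 0$ for $i\in\Lambda$. Let $\Phi$ be the standard Gaussian CDF. Let $B_i(\varepsilon,x)$ and $A_i(\varepsilon,x)$ be the wrong-direction events of the one-step tamed Euler and skew-symmetric schemes, respectively (defined in the context). Then the following hold. (i) Tamed Euler scheme. For $i\in\Lambda$, $$\mathbb{P}\bigl(B_i(\varepsilon,x)\bigr)=1-\Phi\left(\frac{1}{\sqrt h\,|\sigma_i(x)|}\left(\varepsilon-\frac{h\,b_i(x)}{1+h|b_i(x)|}\,\mathrm{sign}(x_i)\right)\right).$$ If furthermore $\lim_{\rho_\Lambda(x)\to\infty}|\sigma_i(x)|=\widetilde\sigma_i\in(0,\infty]$ for all $i\in\Lambda$, then $$\lim_{\rho_\Lambda(x)\to\infty}\mathbb{P}\left(\bigcup_{i\in\Lambda}B_i(\varepsilon,x)\right)=1-\prod_{i\in\Lambda}\Phi\left(\frac{1}{\sqrt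 h\,\widetilde\sigma_i}(\varepsilon+1)\right),$$ with the convention $1/\infty=0$. (ii) Skew-symmetric scheme. For $i\in\Lambda$, $$\mathbb{P}\bigl(A_i(\varepsilon,x)\bigr)=1-\mathbb{E}_{\eta_i\sim N(0,1)}\left[\Phi\left(\frac{\sqrt{1+\tilde\alpha_i(h,x)^2}}{\sqrt h\,|\sigma_i(x)|}\,\varepsilon-\sqrt{\frac{\pi}{2}}\,\frac{b_i(x)}{|\sigma_i(x)|}\,\sqrt h\,|\eta_i|\,\mathrm{sign}(x_i)\right)\right].$$ Furthermore, if $\lim_{\rho_\Lambda(x)\to\infty}\mathrm{sign}(x_i)\,b_i(x)/|\sigma_i(x)|=-\infty$ for all $i\in\Lambda$, then $$\lim_{\rho_\Lambda(x)\to\infty}\mathbb{P}\left(\bigcup_{i\in\Lambda}A_i(\varepsilon,x)\right)=0.$$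
   Context: For non-empty $\Lambda\subseteq\{1,\ldots,d\}$, $\rho_\Lambda(x):=\min_{i\in\Lambda}|x_i|$; limits $\rho_\Lambda(x)\to\infty$ are understood with the remaining coordinates $x_j$, $j\notin\Lambda$, staying in a fixed bounded set. Let $\xi=(\xi_1,\ldots,\xi_d)$ and $\eta=(\eta_1,\ldots,\eta_d)$ be independent $N(0,I_d)$ vectors. One step of the pathwise skew-symmetric scheme from $x$ has coordinates $$\widetilde X_{i,1}=x_i+\sigma_i(x)\sqrt h\left(\frac{\xi_i+\tilde\alpha_i(h,x)|\eta_i|}{\sqrt{1+\tilde\alpha_i(h,x)^2}}\right),\qquad \tilde\alpha_i(h,x)=\sqrt{\frac{\pi}{2}}\,\frac{b_i(x)}{\sigma_i(x)}\sqrt h,$$ and one step of the (component-wise) tamed Euler scheme from $x$ has coordinates $$\hat X_{i,1}=x_i+\frac{h\,b_i(x)}{1+h|b_i(x)|}+\sigma_i(x)\sqrt h\,\xi_i .$$ (Only the coordinates $i\in\Lambda$ are used.) The wrong-direction events, for $i\in\Lambda$, are $$A_i(\varepsilon,x)=\bigl\{\mathrm{sign}(x_i)(\widetilde X_{i,1}-x_i)>\varepsilon\bigr\},\qquad B_i(\varepsilon,x)=\bigl\{\mathrm{sign}(x_i)(\hat X_{i,1}-x_i)>\varepsilon\bigr\}.$$ *)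

(* Defs.v *)
From HB Require Import structures.
From mathcomp Require Import all_boot all_order all_algebra.
From mathcomp Require Import all_classical all_reals all_analysis.
Import Order.TTheory GRing.Theory Num.Theory.
Import numFieldNormedType.Exports.

Set Implicit Arguments.
Unset Strict Implicit.
Unset Printing Implicit Defensive.

Local Open Scope classical_set_scope.
Local Open Scope ring_scope.

(* Points of R^d, both states and noise values, are d-tuples: this is the model
   of R^d that carries the product sigma-algebra in the library. *)

Section limits.
Context {R : realType} {d : nat}.
Implicit Types (Lam : {set 'I_d}) (x : d.-tuple R).

(* Extended-real valued only so that the minimum needs no default value; finite
   when Lam is non-empty. *)
Definition rho Lam x : \bar R :=
  \big[mine/+oo%E]_(i in Lam) `|tnth x i|%:E.

(* The filter "rho Lam x -> oo, with the coordinates outside Lam bounded by r". *)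
Definition rho_infty Lam (r : R) : set_system (d.-tuple R) :=
  filter_from [set: R] (fun M => [set x | (M%:E < rho Lam x)%E /\
                                   forall j, j \notin Lam -> `|tnth x j| <= r]).

End limits.

Section gaussian.
Context {R : realType}.

Definition Phi (z : R) : R := fine (normal_prob 0 1 `]-oo, z]).

Context {dT : measure_display} {T : measurableType dT} (P : probability T R).

(* X ~ N(0, I_d): the law of X is the d-fold product of N(0, 1). *)
Definition std_gaussian_vector (d : nat) (X : {RV P >-> d.-tuple R}) : Prop :=
  forall B : 'I_d -> set R, (forall i, measurable (B i)) ->
    P [set w | forall i, B i (tnth (X w) i)] =
    (\prod_(i < d) normal_prob 0 1 (B i))%E.

Definition independent_RVs (d1 d2 : measure_display)
    (T1 : measurableType d1) (T2 : measurableType d2)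
    (X : {RV P >-> T1}) (Y : {RV P >-> T2}) : Prop :=
  forall (A : set T1) (B : set T2), measurable A -> measurable B ->
    P (X @^-1` A `&` Y @^-1` B) = (P (X @^-1` A) * P (Y @^-1` B))%E.

End gaussian.

Section schemes.
Context {R : realType} {d : nat}.
Variables (h : R) (b : d.-tuple R -> d.-tuple R) (sigma : 'I_d -> d.-tuple R -> R).
Implicit Types (x u v : d.-tuple R) (i : 'I_d).

Definition alpha i x : R :=
  Num.sqrt (pi / 2) * (tnth (b x) i / sigma i x) * Num.sqrt h.

(* In the one-step maps, u and v are the realised values of xi and eta. *)
Definition skew_step i x u v : R :=
  tnth x i + sigma i x * Num.sqrt h *
    ((tnth u i + alpha i x * `|tnth v i|) / Num.sqrt (1 + alpha i x ^+ 2)).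

Definition tamed_step i x u : R :=
  tnth x i + h * tnth (b x) i / (1 + h * `|tnth (b x) i|)
  + sigma i x * Num.sqrt h * tnth u i.

Variables (T : Type) (xi eta : T -> d.-tuple R) (eps : R).

Definition wrong_skew i x : set T :=
  [set w | eps < Num.sg (tnth x i) * (skew_step i x (xi w) (eta w) - tnth x i)].

Definition wrong_tamed i x : set T :=
  [set w | eps < Num.sg (tnth x i) * (tamed_step i x (xi w) - tnth x i)].

End schemes.

(* Main.v *)
Require Import Defs.
From HB Require Import structures.
From mathcomp Require Import all_boot all_order all_algebra.
From mathcomp Require Import all_classical all_reals all_analysis.
From mathcomp Require Import measurable_realfun ring lra.
Import Order.TTheory GRing.Theory Num.Theory.
Import numFieldNormedType.Exports.

(** For a fixed state [x], multiplying the increment of coordinate [i] by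
    [sign (x_i)] turns both wrong-direction events into threshold events
    [a < c * xi_i], where [c = sign (x_i) * sigma_i * sqrt h] does not vanish
    and the threshold [a] is deterministic for the tamed scheme
    ([wrong_tamedE]) and a function of [eta_i] for the skew-symmetric one
    ([wrong_skewE], after multiplication by [sqrt (1 + alpha^2)]).  By symmetry
    of the normal law, [P (a < c * xi_i) = 1 - Phi (a / |c|)]
    ([normal_prob_mull_gt]); this is the tamed formula, and Fubini for the
    independent pair [(xi, eta)] gives the skew one ([prob_random_threshold]).

    Tamed limit: the coordinates of [xi] are independent, so the union has
    probability [1 - prod_i Phi (a_i / |c_i|)] ([prob_bigcup_mull_gt]).  When
    [sign (x_i) * b_i] tends to [-oo], the tamed drift saturates at [-1]
    ([cvg_tamed_drift]), so [a_i] tends to [eps + 1], and continuity of [Phi]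
    concludes.

    Skew limit: since [eps >= 0], the event is included in the cone
    [K * |eta_i| < +/- xi_i] for every [K] below
    [- sqrt (pi / 2) * sqrt h * sign (x_i) * b_i / |sigma_i|]
    ([wrong_skew_sub_cone]), a bound that tends to [+oo].  Such a cone has small
    probability when [K] is large ([prob_steep_cone]): either [eta_i] is close
    to 0, which is unlikely because the normal density is bounded, or [xi_i] is
    large.  A union bound over [Lam] finishes the proof. *)

Local Open Scope classical_set_scope.
Local Open Scope ring_scope.

Set Implicit Arguments.
Unset Strict Implicit.
Unset Printing Implicit Defensive.

(** * The standard normal law and its distribution function *)

Section std_normal.
Context {R : realType}.
Implicit Types (a c z : R) (A : set R).

(** Change of variables [x -> - x]: the density is even and Lebesgue measure is
    invariant under opposite. *)
Lemma normal_probN A : measurable A ->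
  normal_prob 0 1 (-%R @^-1` A) = normal_prob 0 1 A :> \bar R.
Proof.
move=> mA; rewrite /normal_prob.
have mpdf : measurable_fun [set: R] (fun y : R => (normal_pdf 0 1 y)%:E).
  by apply/measurable_EFinP; exact: measurable_normal_pdf.
transitivity (\int[lebesgue_measure]_(x in
   (-%R : _ -> measurableTypeR R) @^-1` A)
   ((fun y => (normal_pdf 0 1 y)%:E) \o -%R) x)%E.
  apply: eq_integral => x _ /=; congr EFin.
  by rewrite !normal_pdfE ?oner_eq0// /normal_fun !subr0 sqrrN.
rewrite -ge0_integral_pushforward//=.
- by apply: eq_measure_integral => /= B mB _; exact: lebesgue_measureN.
- exact: measurable_funTS mpdf.
- by move=> x _; rewrite lee_fin normal_pdf_ge0.
Qed.

(** The density is bounded by its value at the mean.  This one bound gives both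
    the continuity of [Phi] and the smallness of the mass of short intervals. *)
Lemma normal_prob_le A : measurable A ->
  (normal_prob 0 1 A <= (normal_peak (1 : R))%:E * lebesgue_measure A)%E.
Proof.
move=> mA; rewrite -integral_cst//; apply: ge0_le_integral => //.
- by move=> x _; rewrite lee_fin normal_pdf_ge0.
- apply: measurable_funTS; apply/measurable_EFinP.
  exact: measurable_normal_pdf.
- by move=> x _; rewrite lee_fin normal_pdf_ub ?oner_eq0.
Qed.

Lemma PhiE z : (Phi z)%:E = normal_prob 0 1 `]-oo, z].
Proof. by rewrite /Phi fineK// fin_num_measure. Qed.

Lemma Phi_ge0 z : 0 <= Phi z.
Proof. by rewrite -lee_fin PhiE. Qed.

Lemma Phi_le1 z : Phi z <= 1.
Proof. by rewrite -lee_fin PhiE probability_le1. Qed.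

Lemma Phi_nondecreasing : nondecreasing_fun (Phi : R -> R).
Proof.
by move=> a z az; rewrite -lee_fin !PhiE le_measure ?inE//; exact: subitvPr.
Qed.

Lemma Phi_lipschitz a z : a <= z -> Phi z - Phi a <= normal_peak 1 * (z - a).
Proof.
move=> az; rewrite lerBlDl -lee_fin EFinD !PhiE.
have <- : (`]-oo, a] `|` `]a, z])%classic = `]-oo, z]%classic :> set R.
  by rewrite -itv_bndbnd_setU.
apply: (le_trans (measureU2 _ _ _)) => //; rewrite leeD2l//.
apply: (le_trans (normal_prob_le _)) => //.
by rewrite lebesgue_measure_itv/= lte_fin; case: ifP => // _;
  rewrite ?EFinM// mule0 lee_fin mulr_ge0 ?normal_peak_ge0 ?subr_ge0.
Qed.

Lemma continuous_Phi : continuous (Phi : R -> R).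
Proof.
move=> z; apply/cvgrPdist_le => /= e e0.
have p0 : 0 < normal_peak (1 : R) by rewrite normal_peak_gt0 ?oner_eq0.
near=> t.
have : `|z - t| <= e / normal_peak 1.
  by near: t; apply: cvgr_dist_le => //; rewrite divr_gt0.
rewrite ler_pdivlMr// mulrC; apply: le_trans.
have [zt|tz] := leP z t.
  by rewrite !ler0_norm ?subr_le0 ?Phi_nondecreasing// !opprB Phi_lipschitz.
have {}tz := ltW tz.
by rewrite !ger0_norm ?subr_ge0 ?Phi_nondecreasing// Phi_lipschitz.
Unshelve. all: by end_near. Qed.

(** [Phi] is the cumulative distribution function of the identity, seen as a
    random variable on the line equipped with the normal law. *)
Lemma Phi_cvgy : Phi z @[z --> +oo] --> (1 : R).
Proof.
(* The normal law lives on [measurableTypeR R], a copy of [R] whose display is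
   not the default one, so the identity goes between two distinct structures. *)
have mid : measurable_fun [set: measurableTypeR R]
    (idfun : measurableTypeR R -> R) by exact: measurable_id.
pose X : {RV (normal_prob 0 1 : probability _ R) >-> R} :=
  HB.pack (idfun : measurableTypeR R -> R)
    (isMeasurableFun.Build _ _ _ _ _ mid).
exact: fine_cvg (cvg_cdfy1 X).
Qed.

Lemma measurable_Phi : measurable_fun setT (Phi : R -> R).
Proof. exact: nondecreasing_measurable Phi_nondecreasing. Qed.

Lemma normal_prob_gt z : normal_prob 0 1 [set u | z < u] = (1 - Phi z)%:E.
Proof.
have -> : [set u | z < u] = ~` `]-oo, z].
  by apply/seteqP; split=> u /=; rewrite in_itv/= ltNge => /negP.
by rewrite EFinB PhiE -probability_setC.
Qed.

Lemma measurable_mull_gt c z : measurable [set u : R | z < c * u].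
Proof.
have mc : measurable_fun [set: R] (fun u => c * u) by exact: measurable_funM.
rewrite (_ : [set u | _] = [set: R] `&` (fun u => c * u) @^-1` `]z, +oo[).
  by apply: mc => //; exact: measurable_itv.
by apply/seteqP; split => u /=; rewrite in_itv/= andbT => // -[].
Qed.

(** For negative [c] the event is the mirror image of the one for [|c|], hence
    only [|c|] matters. *)
Lemma normal_prob_mull_gt c z : c != 0 ->
  normal_prob 0 1 [set u | z < c * u] = (1 - Phi (z / `|c|))%:E.
Proof.
move=> c0; rewrite -normal_prob_gt.
have mgt a : measurable [set u : R | a < u].
  by rewrite -set_itvoy; exact: measurable_itv.
have [c_gt0|c_lt0|c00] := ltrgt0P c; last by rewrite c00 eqxx in c0.
  congr normal_prob; apply/seteqP.
  by split => u /=; rewrite ltr_pdivrMr// mulrC.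
rewrite -[RHS]normal_probN//; congr normal_prob.
by apply/seteqP; split => u /=; rewrite ltr_pdivrMr ?oppr_gt0// mulrNN mulrC.
Qed.

Lemma normal_prob_mull_le c z : c != 0 ->
  normal_prob 0 1 (~` [set u | z < c * u]) = (Phi (z / `|c|))%:E.
Proof.
move=> c0; transitivity (1 - normal_prob 0 1 [set u | z < c * u]%R)%E.
  by apply: probability_setC; exact: measurable_mull_gt.
by rewrite normal_prob_mull_gt// -EFinB opprB addrC subrK.
Qed.

End std_normal.

(** * Laws of the coordinates of a Gaussian vector, and independence *)

Section laws.
Context {R : realType} {dT : measure_display} {T : measurableType dT}.
Context {P : probability T R}.

Lemma probability_bigsetU_le (I : Type) (s : seq I) (Q : pred I)
    (A : I -> set T) : (forall i, Q i -> measurable (A i)) ->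
  (P (\big[setU/set0]_(i <- s | Q i) A i) <= \sum_(i <- s | Q i) P (A i))%E.
Proof.
move=> mA; elim: s => [|i s IH]; first by rewrite !big_nil measure0.
rewrite !big_cons; case: ifP => // Qi.
have mU : measurable (\big[setU/set0]_(j <- s | Q j) A j).
  exact: bigsetU_measurable.
by apply: (le_trans (measureU2 _ (mA _ Qi) mU)); rewrite leeD2l.
Qed.

Lemma measurable_coord_event (d : nat) (X : {RV P >-> d.-tuple R}) (i : 'I_d)
    (B : set R) : measurable B -> measurable [set w | B (tnth (X w) i)].
Proof.
move=> mB.
have mXi : measurable_fun [set: T] (fun w => tnth (X w) i).
  exact: measurableT_comp (measurable_tnth i) (@measurable_funP _ _ _ _ _ X).
by rewrite -[X in measurable X]setTI; exact: mXi.
Qed.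

(** The product rule defining a Gaussian vector constrains all coordinates at
    once; the coordinates outside [Lam] are left free by taking [setT] there. *)
Lemma std_gaussian_coords (d : nat) (X : {RV P >-> d.-tuple R})
    (Lam : {set 'I_d}) (B : 'I_d -> set R) :
  std_gaussian_vector X -> (forall i, measurable (B i)) ->
  P [set w | forall i, i \in Lam -> B i (tnth (X w) i)] =
  (\prod_(i in Lam) normal_prob 0 1 (B i))%E.
Proof.
move=> gX mB; pose C i := if i \in Lam then B i else setT.
have mC i : measurable (C i) by rewrite /C; case: ifP.
transitivity (P [set w | forall i, C i (tnth (X w) i)]).
  congr (P _); apply/seteqP; split => w /= BC i; rewrite /C.
    by case: ifPn => // /BC.
  by move=> iLam; have := BC i; rewrite /C iLam.
rewrite gX// [RHS]big_mkcond/=; apply: eq_bigr => i _; rewrite /C.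
by case: ifP => // _; rewrite probability_setT.
Qed.

Lemma std_gaussian_coord (d : nat) (X : {RV P >-> d.-tuple R}) (i : 'I_d)
    (B : set R) : std_gaussian_vector X -> measurable B ->
  P [set w | B (tnth (X w) i)] = normal_prob 0 1 B.
Proof.
move=> gX mB; have := std_gaussian_coords [set i]%SET gX (fun=> mB).
rewrite big_set1 => <-; congr (P _); apply/seteqP; split => w /=.
  by move=> Bw j; rewrite inE => /eqP ->.
by apply; rewrite inE.
Qed.

(** Fubini for independent variables: their joint law and the two iterated
    product measures agree on rectangles, hence everywhere. *)
Lemma independent_RVs_section (d1 d2 : measure_display) (T1 : measurableType d1)
    (T2 : measurableType d2) (X : {RV P >-> T1}) (Y : {RV P >-> T2})
    (M : set (T1 * T2)) : independent_RVs X Y -> measurable M ->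
  P [set w | M (X w, Y w)] = (\int[P]_w P [set w' | M (X w', Y w)])%E.
Proof.
move=> XY mM.
have mXY : measurable_fun [set: T] (fun w => (X w, Y w)).
  by apply: measurable_fun_pair; exact: measurable_funP.
pose XYrv : {RV P >-> (T1 * T2)%type} :=
  HB.pack (fun w => (X w, Y w)) (isMeasurableFun.Build _ _ _ _ _ mXY).
transitivity ((distribution P X \x distribution P Y)%E M).
  by rewrite (product_measure_unique (m' := distribution P XYrv)).
transitivity ((distribution P X \x^ distribution P Y)%E M).
  by apply: product_measure_unique => //= A B mA mB; rewrite product_measure2E.
rewrite /product_measure2 ge0_integral_distribution//=.
- apply: eq_integral => w _ /=; congr (P _).
  by apply/seteqP; split => w' /=; rewrite /ysection/= in_setE.
- exact: measurable_fun_ysection.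
Qed.

End laws.

(** * Threshold events for Gaussian noise *)

Section schemes.
Context {R : realType} {dT : measure_display} {T : measurableType dT}.
Context {P : probability T R} {d : nat} {xi eta : {RV P >-> d.-tuple R}}.
Hypotheses (gxi : std_gaussian_vector xi) (geta : std_gaussian_vector eta).
Hypothesis indep : independent_RVs xi eta.
Implicit Types (i : 'I_d).

Lemma prob_mull_gt i (c a : R) : c != 0 ->
  P [set w | a < c * tnth (xi w) i] = (1 - Phi (a / `|c|))%:E.
Proof.
move=> c0; rewrite -normal_prob_mull_gt//.
by rewrite -(std_gaussian_coord i gxi (measurable_mull_gt c a)).
Qed.

(** The complement of the union is an intersection of events on distinct
    coordinates of [xi], so its probability is a product. *)
Lemma prob_bigcup_mull_gt (Lam : {set 'I_d}) (c a : 'I_d -> R) :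
  (forall i, i \in Lam -> c i != 0) ->
  P (\bigcup_(i in [set i | i \in Lam])
       [set w | a i < c i * tnth (xi w) i]) =
  (1 - \prod_(i in Lam) Phi (a i / `|c i|))%:E.
Proof.
move=> c0.
have mB i : measurable (~` [set u : R | a i < c i * u]).
  by apply: measurableC; exact: measurable_mull_gt.
have := std_gaussian_coords Lam gxi mB.
have -> : [set w | forall i, i \in Lam ->
      (~` [set u : R | a i < c i * u]) (tnth (xi w) i)] =
    ~` \bigcup_(i in [set i | i \in Lam]) [set w | a i < c i * tnth (xi w) i].
  rewrite setC_bigcup; apply/seteqP; split => w /= H i iLam; exact: H.
rewrite probability_setC; last first.
  apply: fin_bigcup_measurable => [|i _]; first exact: finite_finset.
  exact: (measurable_coord_event xi i (measurable_mull_gt (c i) (a i))).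
rewrite (eq_bigr (fun i => (Phi (a i / `|c i|))%:E)); last first.
  by move=> i /c0 ci0; rewrite normal_prob_mull_le.
rewrite prodEFin EFinB => <-.
by rewrite oppeB// ?addeA ?subee ?add0e.
Qed.

Lemma measurable_random_threshold i (c : R) (g : R -> R) :
  measurable_fun setT g ->
  measurable [set w | g (tnth (eta w) i) < c * tnth (xi w) i].
Proof.
move=> mg.
have mcoord (X : {RV P >-> d.-tuple R}) :
    measurable_fun setT (fun w => tnth (X w) i).
  exact: measurableT_comp (measurable_tnth i) (@measurable_funP _ _ _ _ _ X).
have mf : measurable_fun [set: T]
    (fun w => c * tnth (xi w) i - g (tnth (eta w) i)).
  apply: measurable_funB; first by apply: measurable_funM.
  exact: measurableT_comp mg (mcoord eta).
rewrite (_ : [set w | _] = [set: T] `&`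
  (fun w => c * tnth (xi w) i - g (tnth (eta w) i)) @^-1` `]0, +oo[).
  by apply: mf => //; exact: measurable_itv.
by apply/seteqP; split => w /=; rewrite in_itv/= andbT subr_gt0 => // -[].
Qed.

(** Freezing [eta] by Fubini leaves a deterministic threshold for [xi]. *)
Lemma prob_random_threshold i (c : R) (g : R -> R) : c != 0 ->
  measurable_fun setT g ->
  P [set w | g (tnth (eta w) i) < c * tnth (xi w) i] =
  (1 - 'E_P[fun w => Phi (g (tnth (eta w) i) / `|c|)])%E.
Proof.
move=> c0 mg.
have mti : measurable_fun [set: d.-tuple R] (fun x => tnth x i).
  exact: measurable_tnth.
pose f (z : d.-tuple R * d.-tuple R) := c * tnth z.1 i - g (tnth z.2 i).
have mf : measurable_fun setT f.
  apply: measurable_funB.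
    apply: measurable_funM => //.
    exact: measurableT_comp mti measurable_fst.
  apply: (measurableT_comp mg); exact: measurableT_comp mti measurable_snd.
pose M := f @^-1` `]0, +oo[.
have ME u v : M (u, v) = (g (tnth v i) < c * tnth u i) :> Prop.
  by rewrite /M/= in_itv/= andbT subr_gt0.
have mM : measurable M.
  by rewrite -[M]setTI; apply: mf => //; exact: measurable_itv.
have := independent_RVs_section indep mM.
rewrite (_ : [set w | _] =
    [set w | g (tnth (eta w) i) < c * tnth (xi w) i]); last first.
  by apply/seteqP; split => w /=; rewrite ME.
move=> ->; under eq_integral => w _.
  rewrite (_ : [set w' | _] =
      [set w' | g (tnth (eta w) i) < c * tnth (xi w') i]); last first.
    by apply/seteqP; split => w' /=; rewrite ME.
  rewrite prob_mull_gt// EFinB.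
  over.
have mPhi : measurable_fun [set: T] (fun w => Phi (g (tnth (eta w) i) / `|c|)).
  apply: (measurableT_comp measurable_Phi).
  apply: measurable_funM => //; apply: (measurableT_comp mg).
  exact: measurableT_comp mti (@measurable_funP _ _ _ _ _ eta).
rewrite integralB//=.
- by rewrite integral_cst//= probability_setT mule1 unlock.
- exact: (finite_measure_integrable_cst P 1).
- apply: (@measurable_bounded_integrable _ _ _ P) => //.
  + by rewrite -ge0_fin_numE// fin_num_measure.
  + exists 1; split; rewrite ?num_real// => x x1 w _ /=.
    by rewrite ger0_norm ?Phi_ge0// (le_trans (Phi_le1 _))// ltW.
Qed.

(** Choose [D] with [P (|eta_i| <= D) <= e / 2], then [K] with
    [P (K * D < +/- xi_i) <= e / 2].  The event is covered by these two.
    The bound is uniform in [s], whose sign depends on the state in the scheme. *)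
Lemma prob_steep_cone (e : R) : 0 < e -> exists K : R, forall i (s : R),
  s != 0 ->
  (P [set w | K * `|tnth (eta w) i| < s / `|s| * tnth (xi w) i]%R <= e%:E)%E.
Proof.
move=> e0.
have p0 : 0 < normal_peak (1 : R) by rewrite normal_peak_gt0 ?oner_eq0.
have e20 : 0 < e / 2 by rewrite divr_gt0.
have [M [_ MPhi]] : \forall z \near +oo, 1 - Phi z <= e / 2 :> R.
  have /cvgrPdist_le/(_ _ e20) := @Phi_cvgy R.
  by apply: filterS => z; exact/le_trans/ler_norm.
pose D := e / 4 / normal_peak 1.
have D0 : 0 < D by rewrite !divr_gt0.
exists ((`|M| + 1) / D) => i s s0.
set K := (_ / D).
pose A := [set w | (`[- D, D]%classic : set R) (tnth (eta w) i)].
pose B := [set w | K * D < s / `|s| * tnth (xi w) i].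
have K0 : 0 <= K by rewrite divr_ge0 ?addr_ge0// ltW.
have mA : measurable A by apply: measurable_coord_event; exact: measurable_itv.
have mB : measurable B.
  exact: (measurable_coord_event xi i (measurable_mull_gt _ _)).
have s1 : s / `|s| != 0 by rewrite mulf_neq0 ?invr_eq0 ?normr_eq0.
have mC : measurable [set w | K * `|tnth (eta w) i| < s / `|s| * tnth (xi w) i].
  apply: (@measurable_random_threshold i (s / `|s|) (fun v => K * `|v|)).
  by apply: measurable_funM => //; exact: normr_measurable.
apply: (@le_trans _ _ (P (A `|` B))).
  rewrite le_measure ?inE//; first exact: measurableU.
  move=> w /= Kw; have [vD|Dv] := leP `|tnth (eta w) i| D.
    by left; rewrite /A/= in_itv/= -ler_norml.
  by right; apply: le_lt_trans Kw; rewrite ler_wpM2l// ltW.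
have PAB : (P (A `|` B) <= P A + P B)%E by exact: measureU2.
apply: (le_trans PAB); rewrite [e]splitr EFinD leeD//.
  have -> : P A = normal_prob 0 1 `[- D, D].
    by apply: std_gaussian_coord => //; exact: measurable_itv.
  apply: (le_trans (normal_prob_le _)); first exact: measurable_itv.
  rewrite lebesgue_measure_itv/= lte_fin gtrN// -EFinM lee_fin.
  have -> : normal_peak 1 * (D - - D) = e / 2.
    by rewrite /D; field; rewrite gt_eqF.
  by [].
rewrite /B prob_mull_gt// lee_fin; apply: MPhi.
rewrite normf_div normr_id divff ?normr_eq0// divr1 /K divfK ?gt_eqF//.
by rewrite ltr_pwDr// ler_norm.
Qed.

End schemes.

(** * The wrong-direction events as threshold events *)

Section steps.
Context {R : realType} {d : nat} {T : Type} {xi eta : T -> d.-tuple R}.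
Variables (eps h : R) (b : d.-tuple R -> d.-tuple R).
Variables (sigma : 'I_d -> d.-tuple R -> R) (i : 'I_d) (x : d.-tuple R).
Hypotheses (h0 : 0 < h) (x0 : tnth x i != 0) (s0 : sigma i x != 0).

(** The coefficient of [xi_i] in the increment of coordinate [i], counted
    positively in the direction away from the origin.  Both schemes share it up
    to the factor [sqrt (1 + alpha^2)]. *)
Definition noise_coef : R := Num.sg (tnth x i) * (sigma i x * Num.sqrt h).

Lemma noise_coef_neq0 : noise_coef != 0.
Proof. by rewrite !mulf_neq0 ?sgr_eq0 ?sqrtr_eq0 -?ltNge. Qed.

Lemma normr_noise_coef : `|noise_coef| = Num.sqrt h * `|sigma i x|.
Proof.
by rewrite !normrM normr_sg x0 mul1r mulrC [`|Num.sqrt h|]ger0_norm// sqrtr_ge0.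
Qed.

Lemma wrong_tamedE : wrong_tamed h b sigma xi eps i x =
  [set w | eps - h * tnth (b x) i / (1 + h * `|tnth (b x) i|)
                 * Num.sg (tnth x i) < noise_coef * tnth (xi w) i].
Proof.
apply/seteqP; split => w; rewrite /wrong_tamed /tamed_step /noise_coef/=;
  rewrite ltrBlDr; congr (is_true (_ < _)); ring.
Qed.

Let q := Num.sqrt (1 + alpha h b sigma i x ^+ 2).

Lemma skew_scale_gt0 : 0 < q.
Proof. by rewrite sqrtr_gt0 ltr_pwDl// sqr_ge0. Qed.

Lemma wrong_skewE : wrong_skew h b sigma xi eta eps i x =
  [set w | q * eps - noise_coef * (alpha h b sigma i x * `|tnth (eta w) i|)
           < noise_coef * tnth (xi w) i].
Proof.
have q0 := skew_scale_gt0.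
suff E w : (eps < Num.sg (tnth x i) *
      (skew_step h b sigma i x (xi w) (eta w) - tnth x i)) =
    (q * eps - noise_coef * (alpha h b sigma i x * `|tnth (eta w) i|)
     < noise_coef * tnth (xi w) i).
  by apply/seteqP; split => w; rewrite /wrong_skew /= E.
rewrite -[LHS](ltr_pM2l q0) ltrBlDr /skew_step /noise_coef -/q.
by congr (_ < _); field; exact: lt0r_neq0.
Qed.

(** The sign of [sigma] cancels between [alpha] and the noise coefficient,
    which is why only [|sigma|] appears in the formula for the skew scheme. *)
Lemma alpha_noise_coef : alpha h b sigma i x * noise_coef / `|noise_coef| =
  Num.sqrt (pi / 2) * (tnth (b x) i / `|sigma i x|) * Num.sqrt h
  * Num.sg (tnth x i).
Proof.
rewrite normr_noise_coef /alpha /noise_coef; field.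
by rewrite normr_eq0 s0 /= sqrtr_eq0 -ltNge h0.
Qed.

(** The threshold is a nonnegative term, proportional to [eps], plus [|eta_i|]
    times a slope [- alpha * c / |c|], with [c] the noise coefficient, which the
    second hypothesis bounds below by [K]. *)
Lemma wrong_skew_sub_cone (K : R) : 0 <= eps ->
  Num.sg (tnth x i) * tnth (b x) i / `|sigma i x| <=
    - K / (Num.sqrt (pi / 2) * Num.sqrt h) ->
  wrong_skew h b sigma xi eta eps i x `<=`
  [set w | K * `|tnth (eta w) i| <
           noise_coef / `|noise_coef| * tnth (xi w) i].
Proof.
move=> eps0; set k := _ * Num.sqrt h.
have k0 : 0 < k by rewrite mulr_gt0 ?sqrtr_gt0// divr_gt0 ?pi_gt0.
rewrite ler_pdivlMr// => uK; rewrite wrong_skewE => w /=.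
have nc0 : 0 < `|noise_coef| by rewrite normr_gt0 noise_coef_neq0.
have ic0 : 0 < `|noise_coef|^-1 by rewrite invr_gt0.
rewrite -(ltr_pM2r ic0) => cw.
rewrite [ltRHS]mulrAC; apply: le_lt_trans cw; rewrite mulrBl.
have q0 : 0 <= q * eps / `|noise_coef|.
  exact: mulr_ge0 (mulr_ge0 (ltW skew_scale_gt0) eps0) (ltW ic0).
rewrite (_ : noise_coef * _ / _ =
  alpha h b sigma i x * noise_coef / `|noise_coef| * `|tnth (eta w) i|);
  last by ring.
rewrite alpha_noise_coef.
have : K * `|tnth (eta w) i| <=
    - (Num.sg (tnth x i) * tnth (b x) i / `|sigma i x| * k) * `|tnth (eta w) i|.
  by rewrite ler_wpM2r// lerNr.
by rewrite /k; lra.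
Qed.

End steps.

(** * Limits of thresholds *)

Section limits.
Context {R : realType}.

Lemma rho_infty_filter (d : nat) (Lam : {set 'I_d}) (r : R) :
  Filter (rho_infty Lam r).
Proof.
apply: filter_from_filter; first by exists 0.
move=> M N _ _; exists (Num.max M N) => // x /= [].
by rewrite EFin_max gt_max => /andP[? ?] ?; split.
Qed.

Context {I : Type} {F : set_system I} {FF : Filter F}.

(** With [u = sign y * b], which is eventually negative, the expression equals
    [(1 - h * u)^-1 - 1]. *)
Lemma cvg_tamed_drift (h : R) (y b : I -> R) : 0 < h ->
  (\forall x \near F, y x != 0) ->
  (Num.sg (y x) * b x) @[x --> F] --> -oo ->
  (h * b x / (1 + h * `|b x|) * Num.sg (y x)) @[x --> F] --> (- 1 : R).
Proof.
move=> h0 y0 ybNy.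
have inv0 : (1 - h * (Num.sg (y x) * b x))^-1 @[x --> F] --> (0 : R).
  apply/gtr0_cvgV0.
    near=> x; rewrite subr_gt0 (@lt_trans _ _ 0)// pmulr_rlt0//.
    by near: x; exact: cvgrNy_lt.
  apply/cvgryPge => A; near=> x.
  have : Num.sg (y x) * b x <= - A / h by near: x; exact: cvgrNy_le.
  by rewrite ler_pdivlMr// mulrC; lra.
rewrite -[X in _ --> X]add0r.
apply: cvg_trans (cvgB inv0 (cvg_cst (1 : R))); apply: near_eq_cvg; near=> x.
have yx0 : y x != 0 by near: x.
have ybx : Num.sg (y x) * b x < 0 by near: x; exact: cvgrNy_lt.
have -> : `|b x| = - (Num.sg (y x) * b x).
  by rewrite -ltr0_norm// normrM normr_sg yx0 mul1r.
have nz : 1 - h * (Num.sg (y x) * b x) != 0.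
  by rewrite gt_eqF// subr_gt0 (@lt_trans _ _ 0)// pmulr_rlt0.
rewrite mulrN; transitivity ((1 - h * (Num.sg (y x) * b x))^-1 - 1) => //.
by field.
Unshelve. all: by end_near. Qed.

(** The case [st = +oo] is where the convention [1 / oo = 0] enters: the inverse
    of [+oo] is 0 in the extended reals. *)
Lemma cvg_inv_scale (k : R) (s : I -> R) (st : \bar R) : 0 < k -> (0 < st)%E ->
  (\forall x \near F, 0 < s x) ->
  (s x)%:E @[x --> F] --> st ->
  (k * s x)^-1 @[x --> F] --> fine (1 / (k%:E * st))%E.
Proof.
move=> k0; rewrite div1e; case: st => [t|_ s0|//].
  rewrite lte_fin => t0 _ /fine_cvg st.
  rewrite -EFinM fine_invr; apply: cvgV; first by rewrite mulf_neq0 ?gt_eqF.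
  exact: (cvgM (cvg_cst k) st).
move=> /cvgeryP sy; rewrite gt0_muley ?lte_fin// invey.
apply/gtr0_cvgV0; first by apply: filterS s0 => x sx; rewrite mulr_gt0.
apply/cvgryPge => A; near=> x.
rewrite mulrC -ler_pdivrMr//; near: x; exact: cvgry_ge.
Unshelve. all: by end_near. Qed.

Lemma bigmaxe_cvgNy (J : finType) (A : {set J}) (f : J -> I -> R) :
  \big[maxe/-oo%E]_(i in A) (f i x)%:E @[x --> F] --> -oo%E ->
  forall i, i \in A -> f i x @[x --> F] --> -oo.
Proof.
move=> fNy i iA; apply/cvgrNyPlt => M.
near=> x.
have : (\big[maxe/-oo]_(i in A) (f i x)%:E < M%:E)%E.
  by near: x; exact: cvgeNy_lt.
by move=> /bigmax_ltP[_ /(_ _ iA)]; rewrite lte_fin.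
Unshelve. all: by end_near. Qed.

End limits.

(** * Wrong-direction probabilities of the two schemes *)

Theorem proposition2 (R : realType) (dT : measure_display)
  (T : measurableType dT) (P : probability T R)
  (d : nat) (eps h : R) (heps : 0 <= eps) (hh : 0 < h)
  (xi eta : {RV P >-> d.-tuple R})
  (hxi : std_gaussian_vector xi) (heta : std_gaussian_vector eta)
  (hind : independent_RVs xi eta)
  (b : d.-tuple R -> d.-tuple R) (sigma : 'I_d -> d.-tuple R -> R)
  (Lam : {set 'I_d}) (hLam : Lam != finset.set0)
  (S : set (d.-tuple R))
  (hS : forall x, S x -> forall i, i \in Lam -> tnth x i != 0)
  (hsigma : forall x, S x -> forall i, i \in Lam -> sigma i x != 0)
  (r : R)
  (hb : \big[maxe/-oo%E]_(i in Lam) (Num.sg (tnth x i) * tnth (b x) i)%:E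
          @[x --> within S (rho_infty Lam r)] --> -oo%E) :
  ((forall (x : d.-tuple R) (i : 'I_d), S x -> i \in Lam ->
      P (wrong_tamed h b sigma xi eps i x) =
      (1 - Phi (1 / (Num.sqrt h * `|sigma i x|) *
                (eps - h * tnth (b x) i / (1 + h * `|tnth (b x) i|)
                       * Num.sg (tnth x i))))%:E)
   /\
   (forall sigmat : 'I_d -> \bar R,
      (forall i, i \in Lam -> (0 < sigmat i)%E) ->
      (forall i, i \in Lam ->
         `|sigma i x|%:E @[x --> within S (rho_infty Lam r)] --> sigmat i) ->
      P (\bigcup_(i in [set i | i \in Lam]) wrong_tamed h b sigma xi eps i x)
        @[x --> within S (rho_infty Lam r)] -->
      (1 - \prod_(i in Lam)
             Phi (fine (1 / ((Num.sqrt h)%:E * sigmat i))%E * (eps + 1)))%:E))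
  /\
  ((forall (x : d.-tuple R) (i : 'I_d), S x -> i \in Lam ->
      P (wrong_skew h b sigma xi eta eps i x) =
      (1 - 'E_P[fun w => Phi (
             Num.sqrt (1 + alpha h b sigma i x ^+ 2)
               / (Num.sqrt h * `|sigma i x|) * eps
             - Num.sqrt (pi / 2) * (tnth (b x) i / `|sigma i x|) * Num.sqrt h
               * `|tnth (eta w) i| * Num.sg (tnth x i))])%E)
   /\
   ((forall i, i \in Lam ->
       (Num.sg (tnth x i) * tnth (b x) i / `|sigma i x|)
         @[x --> within S (rho_infty Lam r)] --> -oo) ->
    P (\bigcup_(i in [set i | i \in Lam])
         wrong_skew h b sigma xi eta eps i x)
      @[x --> within S (rho_infty Lam r)] --> 0%E)).
Proof.
set F := within S (rho_infty Lam r).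
have FF : Filter F by apply: within_filter; exact: rho_infty_filter.
have FS : \forall x \near F, S x.
  by apply: near_withinT; exact: rho_infty_filter.
have sh0 : 0 < Num.sqrt h by rewrite sqrtr_gt0.
split; split.
- move=> x i Sx iLam; have x0 := hS _ Sx _ iLam; have s0 := hsigma _ Sx _ iLam.
  rewrite wrong_tamedE (prob_mull_gt hxi) ?noise_coef_neq0//.
  by rewrite normr_noise_coef// div1r mulrC.
- move=> sigmat st0 st.
  pose a i (x : d.-tuple R) :=
    (eps - h * tnth (b x) i / (1 + h * `|tnth (b x) i|) * Num.sg (tnth x i)) /
    (Num.sqrt h * `|sigma i x|).
  pose l i := fine (1 / ((Num.sqrt h)%:E * sigmat i))%E * (eps + 1).
  have ca i : i \in Lam -> a i x @[x --> F] --> l i.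
    move=> iLam; rewrite /l mulrC; apply: cvgM.
      rewrite -[X in eps + X]opprK; apply: cvgB; first exact: cvg_cst.
      apply: (cvg_tamed_drift hh); last exact: bigmaxe_cvgNy hb _ iLam.
      by apply: filterS FS => x Sx; exact: hS.
    apply: cvg_inv_scale => //; [exact: st0| |exact: st].
    by apply: filterS FS => x Sx; rewrite normr_gt0 hsigma.
  have cprod : (1 - \prod_(i in Lam) Phi (a i x)) @[x --> F] -->
      1 - \prod_(i in Lam) Phi (l i).
    apply: cvgB; first exact: cvg_cst.
    apply: cvg_big => [|i iLam]; first exact: mul_continuous.
    apply: (cvg_comp _ _ (ca i iLam)); exact: continuous_Phi.
  have : (EFin \o (fun x => 1 - \prod_(i in Lam) Phi (a i x))) @ F -->
      (1 - \prod_(i in Lam) Phi (l i))%:E.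
    by apply: cvg_EFin => //; exact: nearW.
  apply: cvg_trans; apply: near_eq_cvg; apply: filterS FS => x Sx /=.
  pose c i := noise_coef h sigma i x.
  under eq_bigcupr do rewrite wrong_tamedE.
  rewrite (prob_bigcup_mull_gt hxi) => [|i iLam]; last first.
    by apply: noise_coef_neq0 => //; [exact: hS|exact: hsigma].
  congr (1 - _)%:E; apply: eq_bigr => i iLam.
  by rewrite normr_noise_coef// hS.
- move=> x i Sx iLam; have x0 := hS _ Sx _ iLam; have s0 := hsigma _ Sx _ iLam.
  have c0 := noise_coef_neq0 hh x0 s0.
  rewrite wrong_skewE//.
  pose c := noise_coef h sigma i x.
  pose q := Num.sqrt (1 + alpha h b sigma i x ^+ 2).
  rewrite (@prob_random_threshold _ _ _ _ _ _ _ hxi hind i c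
    (fun v => q * eps - c * (alpha h b sigma i x * `|v|)))//; last first.
    apply: measurable_funB => //; apply: measurable_funM => //.
    by apply: measurable_funM.
  congr (1 - 'E_P[_])%E; apply/funext => w; congr Phi.
  rewrite mulrBl; congr (_ - _); first by rewrite /c normr_noise_coef// mulrAC.
  transitivity (alpha h b sigma i x * c / `|c| * `|tnth (eta w) i|).
    by ring.
  by rewrite /c alpha_noise_coef// mulrAC.
- move=> hbs.
  have mg (c1 c2 : R) : measurable_fun setT (fun v : R => c1 - c2 * `|v|).
    by apply: measurable_funB => //; exact: measurable_funM.
  have mA i x : measurable (wrong_skew h b sigma xi eta eps i x).
    rewrite wrong_skewE//; under eq_set do rewrite mulrA.
    exact: (measurable_random_threshold i _ (mg _ _)).
  pose p i x := fine (P (wrong_skew h b sigma xi eta eps i x)).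
  have cA i : i \in Lam -> p i x @[x --> F] --> (0 : R).
    move=> iLam; apply/cvgr0Pnorm_le => e e0.
    have [K PK] := prob_steep_cone hxi heta e0.
    near=> x.
    have Sx : S x by near: x.
    have x0 := hS _ Sx _ iLam; have s0 := hsigma _ Sx _ iLam.
    have c0 := noise_coef_neq0 hh x0 s0.
    rewrite /p ger0_norm ?fine_ge0// -lee_fin fineK ?fin_num_measure//.
    apply: le_trans (PK i _ c0); apply: le_measure; rewrite ?inE//.
      (* the threshold [K * |v|] is [0 - (- K) * |v|] *)
      pose c := noise_coef h sigma i x.
      have := measurable_random_threshold (xi := xi) (eta := eta) i (c / `|c|)
        (mg 0 (- K)).
      by under eq_set do rewrite sub0r mulNr opprK.
    apply: wrong_skew_sub_cone => //; near: x; apply: cvgrNy_le; exact: hbs.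
  have sp : (\sum_(i in Lam) p i x) @[x --> F] --> (0 : R).
    have : (\sum_(i in Lam) p i x) @[x --> F] --> (\sum_(i in Lam) 0 : R).
      by apply: cvg_big => [|i iLam]; [exact: add_continuous|exact: cA].
    by rewrite big1.
  apply: (@squeeze_cvge _ _ _ _ (cst 0%E) _
    (EFin \o (fun x => \sum_(i in Lam) p i x))).
  + apply: nearW => x; rewrite /= measure_ge0/= (bigcup_pred (mem Lam)).
    apply: (le_trans (probability_bigsetU_le _ _)) => //.
    rewrite -sumEFin; apply: lee_sum => i _.
    by rewrite /p fineK// fin_num_measure.
  + exact: cvg_cst.
  + by apply: cvg_EFin => //; exact: nearW.
Unshelve. all: by end_near.
Qed.
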